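(* Let $\Delta$ be a finite simplicial complex with vertex set $V$, let $f:V\to\mathbb{R}$ be injective and discrete smooth on $\Delta$, and let $M$ be the greedy matching on the weighted Hasse diagram of $\Delta$. A simplex $\sigma\in\Delta$ is critical if and only if $h_f(\sigma)\in\sigma$ and $h_f(\sigma\setminus h_f(\sigma))\notin\sigma$.
   Context: A finite simplicial complex $\Delta$ with (nonempty, finite) vertex set $V$ is a family of subsets of $V$ (simplices) containing every singleton $\{v\}$, $v\in V$, and closed under taking subsets (so $\emptyset\in\Delta$, of dimension $-1$, and $\emptyset$ is a node of the Hasse diagram). $\dim\sigma=|\sigma|-1$. We write $\sigma\prec\tau$ (or $\tau\succ\sigma$) if $\sigma\subset\tau$ and $\dim\sigma=\dim\tau-1$. A vertex $v$ is identified with $\{v\}$ in expressions such as $\sigma\setminus v$. The Hasse diagram $H$ of $\Delta$ has the simplices of $\Delta$ as nodes and an arc $\{\sigma,\tau\}$ for each pair $\sigma\prec\tau$. The weight of the arc $\{\sigma,\tau\}$ is $f(v)$, where $\tau\setminus\sigma=\{v\}$. Two arcs sharing a node always have different weights. Greedy matching $M$: start with $M=\emptyset$; while arcs remain, add all remaining arcs of minimum weight to $M$ and delete the end nodes of these arcs (with all their incident arcs). A simplex is critical if it belongs to no arc of $M$. For $\sigma\in\Delta$, $H(\sigma)=\{v\in V:\ v\in\sigma,\text{ or } v\notin\sigma\text{ and }\sigma\cup\{v\}\in\Delta\}$ (the vertices whose $f$-values are the weights of the arcs incident to $\sigma$), and $h_f(\sigma)$ is the unique vertex of $H(\sigma)$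 at which $f$ is minimal. A simplex $\sigma\in\Delta$ is discrete smooth if: whenever $h_f(\sigma)\in\sigma$, then for all $\tau\succ\sigma$ one has $h_f(\tau\setminus h_f(\sigma))=h_f(\sigma)$. The function $f$ is discrete smooth on $\Delta$ if every $\sigma\in\Delta$ is discrete smooth. *)

(* Defs.v *)
From mathcomp Require Import all_boot all_order all_algebra.
From mathcomp Require Import reals.

Set Implicit Arguments.
Unset Strict Implicit.
Unset Printing Implicit Defensive.

Import Order.TTheory GRing.Theory Num.Theory.
Local Open Scope ring_scope.

(* The empty face is a simplex as soon as the vertex type is nonempty. *)
Definition simplicial_complex (V : finType) (Delta : {set {set V}}) : Prop :=
  (forall v : V, [set v] \in Delta) /\
  (forall s t : {set V}, t \in Delta -> s \subset t -> s \in Delta).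

(* With dim s = #|s| - 1, the second condition says dim s = dim t - 1. *)
Definition covered (V : finType) (s t : {set V}) : bool :=
  (s \subset t) && (#|t| == #|s|.+1).

Section HasseDiagram.

Variables (R : realType) (V : finType) (f : V -> R).

(* The arc {s, t} with s covered by t is represented by the pair (s, t). *)
Definition hasse_arcs (N : {set {set V}}) : {set {set V} * {set V}} :=
  [set a | [&& a.1 \in N, a.2 \in N & covered a.1 a.2]].

(* On an arc, a.2 :\: a.1 is a singleton; the value 0 is never used there. *)
Definition weight (a : {set V} * {set V}) : R :=
  if [pick v in a.2 :\: a.1] is Some v then f v else 0.

Definition min_arcs (A : {set {set V} * {set V}}) : {set {set V} * {set V}} :=
  [set a in A | [forall b in A, weight a <= weight b]].

Definition end_nodes (A : {set {set V} * {set V}}) : {set {set V}} :=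
  [set a.1 | a in A] :|: [set a.2 | a in A].

(* A state is (arcs matched so far, nodes not yet deleted); the remaining arcs
   are those with both ends among the remaining nodes. *)
Definition greedy_step
    (x : {set {set V} * {set V}} * {set {set V}}) :
    {set {set V} * {set V}} * {set {set V}} :=
  let B := min_arcs (hasse_arcs x.2) in (x.1 :|: B, x.2 :\: end_nodes B).

Definition greedy_state (Delta : {set {set V}}) (n : nat) :
    {set {set V} * {set V}} * {set {set V}} :=
  iter n greedy_step (set0, Delta).

(* A step deletes a node whenever an arc remains, and does nothing otherwise,
   so #|Delta| steps run the loop to its end (see greedy_exhausts). *)
Definition greedy_matching (Delta : {set {set V}}) : {set {set V} * {set V}} :=
  (greedy_state Delta #|Delta|).1.

Definition critical (Delta : {set {set V}}) (M : {set {set V} * {set V}})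
    (s : {set V}) : Prop :=
  s \in Delta /\ s \notin end_nodes M.

Lemma min_arcs_eq0 A : min_arcs A = set0 -> A = set0.
Proof.
move=> mA0; apply/eqP; apply/negP => /negP /set0Pn[a0 a0A].
case: (Order.TotalTheory.arg_minP weight a0A) => a aA aP.
have : a \in min_arcs A by rewrite inE; apply/andP; split=> //; apply/forall_inP.
by rewrite mA0 inE.
Qed.

Lemma greedy_exhausts Delta : hasse_arcs (greedy_state Delta #|Delta|).2 = set0.
Proof.
have step n : hasse_arcs (greedy_state Delta n).2 = set0 \/
    (#|(greedy_state Delta n).2| + n <= #|Delta|)%N.
  elim: n => [|n IHn]; first by right; rewrite addn0.
  rewrite /greedy_state iterS -/(greedy_state Delta n).
  move: (greedy_state Delta n) IHn => [M N] /= IHn.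
  have [mA0|/set0Pn[a aB]] := eqVneq (min_arcs (hasse_arcs N)) set0.
    left; rewrite mA0 /end_nodes !imset0 setU0 setD0.
    exact: min_arcs_eq0.
  have aN : a \in hasse_arcs N by move: aB; rewrite inE => /andP[].
  case: IHn => [A0|lenD]; first by rewrite A0 inE in aN.
  right; rewrite addnS -addSn; apply: leq_trans lenD; rewrite leq_add2r.
  apply: proper_card; apply/properP; split; first exact: subsetDl.
  move: aN; rewrite inE => /and3P[a1N _ _]; exists a.1 => //.
  by rewrite !inE (imset_f (fun a => a.1) aB).
have [//|] := step #|Delta|.
rewrite -[leqRHS]add0n leq_add2r leqn0 cards_eq0 => /eqP ->.
by apply/setP => a; rewrite !inE.
Qed.

End HasseDiagram.

Definition some_vertex (V : finType) (V0 : (0 < #|V|)%N) : V :=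
  enum_val (Ordinal V0).

Definition vertex_nbhd (V : finType) (Delta : {set {set V}}) (s : {set V}) :
    {set V} :=
  [set v | (v \in s) || (v \notin s) && (v |: s \in Delta)].

(* some_vertex V0 is only a default value: for s in Delta, vertex_nbhd Delta s
   is nonempty and the minimum is attained in it (see hfP). *)
Definition hf (R : realType) (V : finType) (V0 : (0 < #|V|)%N)
    (Delta : {set {set V}}) (f : V -> R) (s : {set V}) : V :=
  [arg min_(v < some_vertex V0 in vertex_nbhd Delta s) f v]%O.

Lemma hfP (R : realType) (V : finType) (V0 : (0 < #|V|)%N)
    (Delta : {set {set V}}) (f : V -> R) (s : {set V}) (v : V) :
  simplicial_complex Delta -> injective f ->
  (hf V0 Delta f s = v <->
   v \in vertex_nbhd Delta s /\
   forall w, w \in vertex_nbhd Delta s -> f v <= f w).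
Proof.
move=> [Delta1 _] f_inj.
have [v0 v0H] : exists v0, v0 \in vertex_nbhd Delta s.
  have [->|/set0Pn[v0 v0s]] := eqVneq s set0; last first.
    by exists v0; rewrite inE v0s.
  by exists (some_vertex V0); rewrite !inE setU0 Delta1.
have [hH hmin] : hf V0 Delta f s \in vertex_nbhd Delta s /\
    forall w, w \in vertex_nbhd Delta s -> f (hf V0 Delta f s) <= f w.
  rewrite /hf /Order.arg_min /extremum; case: pickP => [x /andP[xH /forall_inP xP]|noP] //=.
  case: (Order.TotalTheory.arg_minP f v0H) => x xH xP.
  by have /andP[] := noP x; split=> //; apply/forall_inP.
split=> [<- //|[vH vmin]]; apply: f_inj; apply/eqP.
by rewrite eq_le hmin // vmin.
Qed.

Definition discrete_smooth_at (R : realType) (V : finType) (V0 : (0 < #|V|)%N)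
    (Delta : {set {set V}}) (f : V -> R) (s : {set V}) : Prop :=
  hf V0 Delta f s \in s ->
  forall t : {set V}, t \in Delta -> covered s t ->
    hf V0 Delta f (t :\ hf V0 Delta f s) = hf V0 Delta f s.

Definition discrete_smooth (R : realType) (V : finType) (V0 : (0 < #|V|)%N)
    (Delta : {set {set V}}) (f : V -> R) : Prop :=
  forall s : {set V}, s \in Delta -> discrete_smooth_at V0 Delta f s.

(* Main.v *)
(** An arc whose weight is minimal at both of its ends is never destroyed by the
    greedy procedure, so it is matched.  Vertex neighbourhoods decrease along
    inclusion, so the arc between [s :\ v] and [v |: s] has this property as
    soon as [v] is the minimal vertex of [s :\ v]; this gives the direct
    implication.  Conversely, every neighbour of [s] in the Hasse diagram is an
    end of such an arc avoiding [s] (smoothness is used at [s] for [u |: s],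
    and at [s :\ u] when [s :\ u] contains its own minimal vertex); since the
    matched arcs are disjoint, [s] is unmatched. *)
Require Import Defs.
From mathcomp Require Import all_boot all_order all_algebra.
From mathcomp Require Import reals.

Set Implicit Arguments.
Unset Strict Implicit.
Unset Printing Implicit Defensive.

Import Order.TTheory GRing.Theory Num.Theory.
Local Open Scope ring_scope.

(* The arc of weight [f v] at the node [x], whether or not [v] belongs to [x]. *)
Definition arc (V : finType) (x : {set V}) (v : V) : {set V} * {set V} :=
  (x :\ v, v |: x).

(** * Arcs of the Hasse diagram indexed by a node and a vertex *)

Section Arcs.

Variables (V : finType).
Implicit Types (x y s : {set V}) (v : V) (a b : {set V} * {set V}).

(** Together with [arcU1], this re-indexes an arc by its other end, so that two arcs can be compared
    at a common node. *)
Lemma arcD1 x v : arc (x :\ v) v = arc x v.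
Proof.
by congr (_, _); apply/setP => u; rewrite !inE; case: (u == v).
Qed.

Lemma arcU1 x v : arc (v |: x) v = arc x v.
Proof.
by congr (_, _); apply/setP => u; rewrite !inE; case: (u == v).
Qed.

Lemma arc_notin x v : v \notin x -> arc x v = (x, v |: x).
Proof. by move=> vx; rewrite /arc (setDidPl _) // disjoint_sym disjoints1. Qed.

Lemma arc_in x v : v \in x -> arc x v = (x :\ v, x).
Proof. by move=> vx; rewrite /arc (setUidPr _) // sub1set. Qed.

Lemma covered_arc x v : covered (arc x v).1 (arc x v).2.
Proof.
rewrite -arcD1 arc_notin ?setD11 // /covered subsetUr cardsU1 setD11 /=.
by rewrite add1n.
Qed.

Lemma node_arc x v : x \in [set (arc x v).1; (arc x v).2].
Proof.
have [vx|vx] := boolP (v \in x); first by rewrite arc_in // set22.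
by rewrite arc_notin // set21.
Qed.

(** The vertex is the single element of [a.2 :\: a.1]; arcs at a fixed node are thus handled through
    their vertices. *)
Lemma covered_arcP a x : covered a.1 a.2 -> x \in [set a.1; a.2] ->
  exists v, a = arc x v.
Proof.
case: a => s t /= /andP[st /eqP tE] xa.
have /cards1P[v tsE] : #|t :\: s| == 1%N by rewrite cardsDS // tE subSnn.
have /setDP[_ vs] : v \in t :\: s by rewrite tsE set11.
have tvs : t = v |: s by rewrite -tsE setUC -{1}(setID t s) (setIidPr st).
exists v; case/set2P: xa => ->; rewrite tvs.
  by rewrite arc_notin.
by rewrite arcU1 arc_notin.
Qed.

Lemma end_nodesP (A : {set {set V} * {set V}}) x :
  reflect (exists2 a, a \in A & x \in [set a.1; a.2]) (x \in end_nodes A).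
Proof.
apply: (iffP setUP) => [[]/imsetP[a aA ->]|[a aA /set2P[]->]].
- by exists a; rewrite ?set21.
- by exists a; rewrite ?set22.
- by left; apply: imset_f.
- by right; apply: imset_f.
Qed.

Lemma end_nodes_arc (A : {set {set V} * {set V}}) x v :
  arc x v \in A -> x \in end_nodes A.
Proof.
by move=> xvA; apply/end_nodesP; exists (arc x v) => //; apply: node_arc.
Qed.

Lemma end_nodesU (A B : {set {set V} * {set V}}) :
  end_nodes (A :|: B) = end_nodes A :|: end_nodes B.
Proof. by rewrite /end_nodes !imsetU setUACA. Qed.

Lemma end_nodes_hasse (N : {set {set V}}) : end_nodes (hasse_arcs N) \subset N.
Proof.
apply/subsetP => x /end_nodesP[a]; rewrite inE => /and3P[a1 a2 _].
by case/set2P => ->.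
Qed.

Lemma end_nodesS (A B : {set {set V} * {set V}}) :
  A \subset B -> end_nodes A \subset end_nodes B.
Proof. by move=> AB; apply: setUSS; apply: imsetS. Qed.

End Arcs.

(** * Invariants of the greedy procedure *)

Section Greedy.

Variables (R : realType) (V : finType) (f : V -> R).
Implicit Types (x y s : {set V}) (u v : V) (a b : {set V} * {set V}).
Implicit Types (A : {set {set V} * {set V}}) (N Delta : {set {set V}}).

Lemma weight_arc x v : weight f (arc x v) = f v.
Proof.
rewrite /weight; case: pickP => [w|/(_ v)] /=; rewrite !inE ?eqxx //.
by case: eqVneq => //= [-> //|_]; rewrite andNb.
Qed.

Lemma min_arcs_sub A : min_arcs f A \subset A.
Proof. by apply/subsetP => a; rewrite inE => /andP[]. Qed.

Lemma min_arcs_le A a b : a \in min_arcs f A -> b \in A ->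
  weight f a <= weight f b.
Proof. by rewrite inE => /andP[_ /forall_inP aP] /aP. Qed.

Lemma greedy_stateS Delta n :
  greedy_state f Delta n.+1 = greedy_step f (greedy_state f Delta n).
Proof. by []. Qed.

Lemma greedy_nodes_sub Delta n : (greedy_state f Delta n).2 \subset Delta.
Proof.
elim: n => [//|n IHn]; rewrite greedy_stateS.
exact: subset_trans (subsetDl _ _) IHn.
Qed.

Lemma hasse_arcsS (N N' : {set {set V}}) :
  N \subset N' -> hasse_arcs N \subset hasse_arcs N'.
Proof.
move=> /subsetP NN'; apply/subsetP => a; rewrite !inE.
by move=> /and3P[/NN'-> /NN'-> ->].
Qed.

Lemma greedy_arcs_sub Delta n :
  (greedy_state f Delta n).1 \subset hasse_arcs Delta.
Proof.
elim: n => [|n IHn]; first exact: sub0set.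
rewrite greedy_stateS subUset IHn /=.
exact: subset_trans (min_arcs_sub _) (hasse_arcsS (greedy_nodes_sub _ _)).
Qed.

Lemma greedy_disjoint Delta n :
  [disjoint end_nodes (greedy_state f Delta n).1 & (greedy_state f Delta n).2].
Proof.
elim: n => [|n IHn]; first by rewrite /end_nodes !imset0 setU0 -setI_eq0 set0I.
rewrite greedy_stateS; case: (greedy_state f Delta n) IHn => M N /= MN.
rewrite end_nodesU disjoints_subset subUset -!disjoints_subset.
apply/andP; split; first exact: disjointWr (subsetDl _ _) MN.
by rewrite disjoint_sym disjoints_subset setDE subsetIr.
Qed.

(** A newly selected arc has its ends among the remaining nodes, which no earlier arc touches. Two
    arcs selected in the same round have equal weight, so at a common node injectivity of [f]
    identifies them. *)
Lemma greedy_state_matching Delta n x u v : injective f ->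
  arc x u \in (greedy_state f Delta n).1 ->
  arc x v \in (greedy_state f Delta n).1 -> u = v.
Proof.
move=> f_inj; elim: n u v => [|n IHn] u v; first by rewrite inE.
have := greedy_disjoint Delta n.
rewrite greedy_stateS; case: (greedy_state f Delta n) IHn => M N /= IHn MN.
set B := min_arcs _ _.
have BN w : arc x w \in B -> x \in end_nodes M -> False.
  move=> /end_nodes_arc xB xM; have := disjointFr MN xM.
  suff -> : x \in N by [].
  by apply: (subsetP (end_nodes_hasse N)); apply: (subsetP _ _ xB);
    apply/end_nodesS/min_arcs_sub.
move=> /setUP[uM|uB] /setUP[vM|vB]; first exact: IHn.
- by case: (BN _ vB (end_nodes_arc uM)).
- by case: (BN _ uB (end_nodes_arc vM)).
have BA := subsetP (min_arcs_sub (hasse_arcs N)).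
apply: f_inj; rewrite -(weight_arc x u) -(weight_arc x v); apply/eqP.
by rewrite eq_le !(@min_arcs_le (hasse_arcs N)) ?BA.
Qed.

(** If a round deletes an end of [a] through a selected arc [b], then [a] weighs at most as much as
    [b], so it is minimal among the remaining arcs and is selected in that same round. *)
Lemma local_min_matched Delta a : a \in hasse_arcs Delta ->
  (forall x v, x \in [set a.1; a.2] -> arc x v \in hasse_arcs Delta ->
     weight f a <= f v) ->
  a \in greedy_matching f Delta.
Proof.
move=> aD a_min.
have aMN n : a \in (greedy_state f Delta n).1 \/
    a \in hasse_arcs (greedy_state f Delta n).2.
  elim: n => [|n IHn]; first by right.
  have := greedy_nodes_sub Delta n.
  rewrite greedy_stateS; case: (greedy_state f Delta n) IHn => M N /= IHn ND.
  case: IHn => [aM|aN]; first by left; rewrite inE aM.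
  have aB x : x \in [set a.1; a.2] ->
      x \in end_nodes (min_arcs f (hasse_arcs N)) ->
      a \in min_arcs f (hasse_arcs N).
    move=> xa /end_nodesP[b bB xb]; rewrite inE aN; apply/forall_inP => c cN.
    apply: le_trans (min_arcs_le bB cN).
    have bN := subsetP (min_arcs_sub _) _ bB.
    have [v bE] : exists v, b = arc x v.
      by apply: covered_arcP xb; move: bN; rewrite inE => /and3P[].
    rewrite bE weight_arc; apply: a_min xa _; rewrite -bE.
    exact: subsetP (hasse_arcsS ND) _ bN.
  have [aM|aM] := boolP (a \in min_arcs f (hasse_arcs N)).
    by left; rewrite inE aM orbT.
  right; move: aN; rewrite inE => /and3P[a1N a2N a12].
  rewrite inE !in_setD a1N a2N a12 !andbT.
  apply/andP; split; apply: contra aM.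
    by apply: aB; apply: set21.
  by apply: aB; apply: set22.
by have [//|] := aMN #|Delta|; rewrite greedy_exhausts inE.
Qed.

(** * Matched arcs given by minimal vertices *)

Variables (V0 : (0 < #|V|)%N) (Delta : {set {set V}}).
Hypotheses (Delta_complex : simplicial_complex Delta) (f_inj : injective f).

Let h := hf V0 Delta f.
Let M := greedy_matching f Delta.

Lemma hf_nbhd s : h s \in vertex_nbhd Delta s.
Proof. by have [/(_ erefl)[]] := hfP V0 s (h s) Delta_complex f_inj. Qed.

Lemma hf_le s v : v \in vertex_nbhd Delta s -> f (h s) <= f v.
Proof.
by have [/(_ erefl)[_ hP] _] := hfP V0 s (h s) Delta_complex f_inj; apply: hP.
Qed.

Lemma vertex_nbhdE s v : s \in Delta ->
  (v \in vertex_nbhd Delta s) = (v |: s \in Delta).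
Proof.
move=> sD; rewrite inE; have [vs|//] := boolP (v \in s).
by rewrite (setUidPr _) ?sub1set.
Qed.

Lemma arc_hasse s v :
  (arc s v \in hasse_arcs Delta) = (v |: s \in Delta).
Proof.
rewrite inE covered_arc andbT /= andb_idl // => vsD.
apply: (Delta_complex.2 _ _ vsD).
exact: subset_trans (subsetDl _ _) (subsetUr _ _).
Qed.

Lemma hfD1_matched s v : h (s :\ v) = v -> arc s v \in M.
Proof.
move=> hv; have := hf_nbhd (s :\ v); rewrite hv !inE eqxx /= => vsD.
rewrite -arcD1; apply: local_min_matched => [|x w xs]; first by rewrite arc_hasse.
rewrite weight_arc arc_hasse -[in f v]hv => wxD; apply: hf_le.
have sD : s :\ v \in Delta by apply: (Delta_complex.2 _ _ vsD); apply: subsetUr.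
rewrite vertex_nbhdE //; apply: (Delta_complex.2 _ _ wxD); apply: setUS.
(* Both ends contain [s :\ v], so a vertex extending either of them lies in its neighbourhood, where
   [v] is minimal. *)
move: xs; rewrite arc_notin ?setD11 //= => /set2P[]-> //; exact: subsetUr.
Qed.

Lemma hf_matched s : h s \notin s -> arc s (h s) \in M.
Proof.
move=> hs; apply: hfD1_matched; congr h.
by rewrite (setDidPl _) // disjoint_sym disjoints1.
Qed.

End Greedy.

(** * Characterisation of the critical simplices *)

Theorem corollary19 (R : realType) (V : finType) (V0 : (0 < #|V|)%N)
    (Delta : {set {set V}}) (f : V -> R)
    (Delta_complex : simplicial_complex Delta)
    (f_inj : injective f)
    (f_smooth : discrete_smooth V0 Delta f)
    (s : {set V}) (s_Delta : s \in Delta) :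
  critical Delta (greedy_matching f Delta) s <->
  hf V0 Delta f s \in s /\
  hf V0 Delta f (s :\ hf V0 Delta f s) \notin s.
Proof.
have h_le := hf_le V0 Delta_complex f_inj.
have hD1 := @hfD1_matched _ _ _ V0 _ Delta_complex f_inj.
have h_matched := @hf_matched _ _ _ V0 _ Delta_complex f_inj.
set h := hf V0 Delta f in h_le hD1 h_matched *.
set M := greedy_matching f Delta in hD1 h_matched *.
have M_matching x u v : arc x u \in M -> arc x v \in M -> u = v.
  exact: greedy_state_matching f_inj.
split=> [[_ sM]|[hs hsD1]].
  have hs : h s \in s.
    by apply: contraNT sM => /h_matched/end_nodes_arc.
  split=> //; apply: contra sM => ws; apply: (@end_nodes_arc _ _ _ (h s)).
  (* The vertices [h s] and [h (s :\ h s)] each lie in the neighbourhood where the other is minimal,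
     hence coincide. *)
  apply: hD1; apply: f_inj; apply/eqP; rewrite eq_le (h_le s) ?inE ?ws // andbT.
  by apply: h_le; rewrite !inE eqxx /= setD1K.
split=> //; apply/negP => /end_nodesP[a aM sa].
have aD : a \in hasse_arcs Delta.
  exact: subsetP (greedy_arcs_sub _ _ _) _ aM.
have [u aE] : exists u, a = arc s u.
  by apply: covered_arcP sa; move: aD; rewrite inE => /and3P[].
have suD : u |: s \in Delta by move: aD; rewrite aE arc_hasse.
have {aM aE aD sa} uM : arc s u \in M by rewrite -aE.
have [uh|uh] := eqVneq u (h s).
  (* Here the lower end [s :\ h s] is also matched along its own minimal vertex, which would then be
     [h s], an element of [s]. *)
  have /h_matched wM : h (s :\ h s) \notin s :\ h s.
    by apply: contra hsD1 => /setD1P[].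
  have hw : h s = h (s :\ h s) by apply: M_matching wM; rewrite arcD1 -uh.
  by rewrite -hw hs in hsD1.
have hsu : h s \in s :\ u by rewrite !inE eq_sym uh.
have [us|us] := boolP (u \in s); last first.
  (* Smoothness at [s] matches the upper end [u |: s] along [h s], which differs from [u]. *)
  have /hD1 : h ((u |: s) :\ h s) = h s.
    by apply: f_smooth => //; have := covered_arc s u; rewrite arc_notin.
  rewrite -arcU1 in uM => /(M_matching _ _ _ uM) => uhs.
  by rewrite uhs eqxx in uh.
have s1D : s :\ u \in Delta.
  by apply: (Delta_complex.2 _ _ s_Delta); apply: subsetDl.
have [xs|xs] := boolP (h (s :\ u) \in s :\ u).
  have hE : h (s :\ u) = h s.
    apply: f_inj; apply/eqP; rewrite eq_le !h_le // inE ?hsu //.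
    by move: xs => /setD1P[_ ->].
  (* Smoothness at [s :\ u], applied to its coface [s]. *)
  have hw : h (s :\ h s) = h s.
    rewrite -hE; apply: f_smooth => //.
    by have := covered_arc s u; rewrite arc_in.
  by rewrite hw hs in hsD1.
(* The lower end [s :\ u] is matched along its minimal vertex, which must be [u]; comparing with
   [h s] in both neighbourhoods forces [u = h s]. *)
have xM := h_matched _ xs.
rewrite -arcD1 in uM; have xu := M_matching _ _ _ uM xM.
have hsN : h s \in vertex_nbhd Delta (s :\ u) by rewrite inE hsu.
have us' : u \in vertex_nbhd Delta s by rewrite inE us.
case/eqP: uh; apply: f_inj; apply/eqP.
by rewrite eq_le h_le // andbT {1}xu h_le.
Qed.
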